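(* Let $(G,S)$ be a Coxeter system, where $G$ is infinite and indecomposable and $S$ is finite. Let $H\subseteq G$ be a reflection subgroup of finite index. Then any set of reflections generating $H$ contains at least $|S|$ elements.
   Context: A Coxeter system $(G,S)$: $S$ finite, $G=\langle S\mid (s_is_j)^{m_{ij}}=1\rangle$ with $m_{ii}=1$, $m_{ij}\in\{2,\dots,\infty\}$ for $i\ne j$. $G$ is indecomposable if $S$ cannot be written as a disjoint union of two nonempty subsets $S_1,S_2$ with every element of $S_1$ commuting with every element of $S_2$. A reflection in $G$ is an element conjugate to some element of $S$; a reflection subgroup is a subgroup generated by reflections. *)

(* Defs.v *)
(* Coxeter groups via their presentation:
   elements of G are words over S = 'I_n modulo the congruence generated by
   the Coxeter relations (s_i s_j)^{m_ij} = 1 (for finite m_ij). *)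
From mathcomp Require Import all_boot.
Set Implicit Arguments. Unset Strict Implicit. Unset Printing Implicit Defensive.

(* A Coxeter matrix on n generators; None encodes m_ij = infinity. *)
Definition coxeter_matrix (n : nat) (m : 'I_n -> 'I_n -> option nat) : Prop :=
  (forall i, m i i = Some 1) /\
  (forall i j, m i j = m j i) /\
  (forall i j, i != j -> forall k, m i j = Some k -> 2 <= k).

Definition word (n : nat) := seq 'I_n.

Definition rel_word n (i j : 'I_n) (k : nat) : word n :=
  flatten (nseq k [:: i; j]).

(* Equality in G = < S | (s_i s_j)^{m_ij} = 1 > : the congruence on words
   generated by the defining relators. Since m_ii = 1 every generator is an
   involution, so the monoid presented is already the group G. *)
Inductive coxeq n (m : 'I_n -> 'I_n -> option nat) : word n -> word n -> Prop :=
  | coxeq_refl u : coxeq m u u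
  | coxeq_sym u v : coxeq m u v -> coxeq m v u
  | coxeq_trans u v w : coxeq m u v -> coxeq m v w -> coxeq m u w
  | coxeq_rel (l r : word n) i j k :
      m i j = Some k -> coxeq m (l ++ rel_word i j k ++ r) (l ++ r).

(* Group operations on words: product is concatenation, identity is [::],
   inverse is reversal (generators are involutions). *)

Definition cox_infinite n (m : 'I_n -> 'I_n -> option nat) : Prop :=
  ~ exists l : seq (word n), forall g : word n, exists2 c, c \in l & coxeq m g c.

Definition cox_indecomposable n (m : 'I_n -> 'I_n -> option nat) : Prop :=
  ~ exists A : {set 'I_n},
      [/\ A != set0, ~: A != set0 &
          forall i j, i \in A -> j \notin A -> coxeq m [:: i; j] [:: j; i]].

Definition is_reflection n (m : 'I_n -> 'I_n -> option nat) (t : word n) : Prop :=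
  exists w : word n, exists i : 'I_n, coxeq m t (w ++ [:: i] ++ rev w).

Inductive gen_by n (m : 'I_n -> 'I_n -> option nat) (R : word n -> Prop)
  : word n -> Prop :=
  | gen_one : gen_by m R [::]
  | gen_mem w : R w -> gen_by m R w
  | gen_mul u v : gen_by m R u -> gen_by m R v -> gen_by m R (u ++ v)
  | gen_inv u : gen_by m R u -> gen_by m R (rev u)
  | gen_eq u v : gen_by m R u -> coxeq m u v -> gen_by m R v.

Definition is_subgroup n (m : 'I_n -> 'I_n -> option nat) (H : word n -> Prop) : Prop :=
  [/\ H [::], (forall u v, H u -> H v -> H (u ++ v)),
      (forall u, H u -> H (rev u)) & (forall u v, H u -> coxeq m u v -> H v)].

Definition finite_index n (m : 'I_n -> 'I_n -> option nat) (H : word n -> Prop) : Prop :=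
  exists l : seq (word n), forall g : word n, exists2 c, c \in l & H (rev c ++ g).

Definition elem_set n (m : 'I_n -> 'I_n -> option nat) (R : word n -> Prop) : Prop :=
  forall u v, R u -> coxeq m u v -> R v.

Definition has_at_least n (m : 'I_n -> 'I_n -> option nat) (R : word n -> Prop) (k : nat) : Prop :=
  exists f : 'I_k -> word n, (forall a, R (f a)) /\
    (forall a b, coxeq m (f a) (f b) -> a = b).

(* Main.v *)
(* In the geometric representation V with form B, reflections act as
   x |-> x - 2 B(x, a) a.  If H were generated by fewer than |S| reflections, some
   nonzero f in V* would vanish on all their roots, hence be fixed by H, and its
   G-orbit O would be finite.  The form Q = sum of v v^T over O is G-invariant and
   nonzero; since every simple reflection preserves Q and S is connected, Q is a
   nonzero multiple of B.  As f lies in the image of Q, f = B(w, -) for some w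
   in V, and w is again fixed by H.  So w has a finite orbit; differences of
   orbit elements give finite orbits for all simple roots, by connectedness.
   The representation therefore has finite image, and it is faithful (Tits), so
   G is finite. *)
Require Import Defs.
From mathcomp Require Import all_boot all_order all_algebra.
From mathcomp Require Import zify ring lra.
From mathcomp Require Import reals Rstruct trigo.
From Stdlib Require Import Classical.
Set Implicit Arguments. Unset Strict Implicit. Unset Printing Implicit Defensive.
Import Order.TTheory GRing.Theory Num.Theory.

(** * Words and reduced words *)

Section Congruence.
Variables (n : nat) (m : 'I_n -> 'I_n -> option nat).
Local Notation "u =~ v" := (coxeq m u v) (at level 70).

Lemma coxeq_ctx l r u v : u =~ v -> l ++ u ++ r =~ l ++ v ++ r.
Proof.
elim=> {u v} [u|u v _ IH|u v w _ IH1 _ IH2|l' r' i j k mij].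
- exact: coxeq_refl.
- exact: coxeq_sym.
- exact: coxeq_trans IH1 IH2.
- by have := coxeq_rel (l ++ l') (r' ++ r) mij; rewrite !catA.
Qed.

Lemma coxeq_cat u u' v v' : u =~ u' -> v =~ v' -> u ++ v =~ u' ++ v'.
Proof.
move=> /(coxeq_ctx [::] v) /= uu' /(coxeq_ctx u' [::]); rewrite !cats0.
exact: coxeq_trans uu'.
Qed.

Lemma coxeq_odd u v : u =~ v -> odd (size u) = odd (size v).
Proof.
elim=> {u v} // [u v w _ -> _ //|l r i j k _].
by rewrite !size_cat !oddD size_flatten /shape map_nseq /= sumn_nseq oddM.
Qed.

Hypothesis mdiag : forall i, m i i = Some 1.

Lemma coxeq_invol i u : i :: i :: u =~ u.
Proof. exact: (coxeq_rel [::] u (mdiag i)). Qed.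

Lemma coxeq_revK u : u ++ rev u =~ [::].
Proof.
elim: u => [|i u IH]; first exact: coxeq_refl.
rewrite rev_cons -cats1.
apply: coxeq_trans (coxeq_invol i [::]).
by have := coxeq_ctx [:: i] [:: i] IH; rewrite /= -catA.
Qed.

Lemma coxeq_Krev u : rev u ++ u =~ [::].
Proof. by have := coxeq_revK (rev u); rewrite revK. Qed.

Lemma coxeq_cancel u v : u ++ rev v =~ [::] -> u =~ v.
Proof.
move=> uv; have := coxeq_cat uv (coxeq_refl m v); rewrite -catA /=.
apply: coxeq_trans; apply: coxeq_sym.
have := coxeq_cat (coxeq_refl m u) (coxeq_Krev v); rewrite cats0; exact.
Qed.

Definition reduced w := forall u, w =~ u -> size w <= size u.

Lemma reduced_exists w : exists2 u, w =~ u & reduced u.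
Proof.
have [k] := ubnP (size w); elim: k w => // k IH w lt_wk.
case: (classic (reduced w)) => [|nred]; first by exists w => //; apply: coxeq_refl.
have [u nu] := not_all_ex_not _ _ nred.
have [wu /negP] := imply_to_and _ _ nu.
rewrite -ltnNge => lt_uw.
have [|v uv ?] := IH u; first by lia.
by exists v => //; apply: coxeq_trans wu uv.
Qed.

Lemma reduced_coxeq u v : reduced u -> u =~ v -> size v = size u -> reduced v.
Proof. by move=> ru uv e w vw; rewrite e; apply: ru; apply: coxeq_trans uv vw. Qed.

Lemma reduced_catl u v : reduced (u ++ v) -> reduced u.
Proof.
move=> r w uw; have := r _ (coxeq_cat uw (coxeq_refl m v)).
by rewrite !size_cat leq_add2r.
Qed.

Lemma reduced_catr u v : reduced (u ++ v) -> reduced v.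
Proof.
move=> r w vw; have := r _ (coxeq_cat (coxeq_refl m u) vw).
by rewrite !size_cat leq_add2l.
Qed.

(** A reduced word for [i :: v] differs in length from [v] by at most one, and by parity not by
    zero; if [i :: v] is not reduced, it is one letter shorter than [v]. *)
Lemma nreduced_cons i v : reduced v -> ~ reduced (i :: v) ->
  exists2 v', v =~ i :: v' & size v = (size v').+1.
Proof.
move=> rv nr; have [v' vv' rv'] := reduced_exists (i :: v).
have v_iv' : v =~ i :: v'.
  apply: coxeq_trans (coxeq_cat (coxeq_refl m [:: i]) vv').
  exact/coxeq_sym/coxeq_invol.
exists v' => //.
have le1 := rv _ v_iv'.
have le2 := rv' _ (coxeq_sym vv').
have odd1 := coxeq_odd v_iv'.
suff: size v' != size (i :: v).
  move: odd1 le1 le2 => /=; case: (ltngtP (size v) (size v').+1) => //= lt1; lia.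
apply/eqP => e; apply: nr; apply: (reduced_coxeq rv' (coxeq_sym vv')).
by rewrite e.
Qed.

(** * Alternating words and dihedral prefixes *)

Fixpoint alt (i j : 'I_n) k : word n :=
  if k is k'.+1 then i :: alt j i k' else [::].

Lemma size_alt i j k : size (alt i j k) = k.
Proof. by elim: k i j => //= k IH i j; rewrite IH. Qed.

Lemma rel_word_alt i j k : rel_word i j k = alt i j k.*2.
Proof. by elim: k => //= k <-. Qed.

Lemma take_alt i j p q : p <= q -> take p (alt i j q) = alt i j p.
Proof. by elim: p q i j => [|p IH] [|q] i j //= le; rewrite ?take0 ?IH. Qed.

(** Two equal adjacent letters would cancel, so a reduced word in two letters must alternate. *)
Lemma reduced_alt i j w : reduced (i :: w) -> all (mem [:: i; j]) w ->
  w = alt j i (size w).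
Proof.
elim: w i j => //= x w IH i j r /andP[]; rewrite !inE => /orP[]/eqP xE al; rewrite xE in r *.
  by have := r _ (coxeq_invol i w); rewrite /=; lia.
congr cons; apply: IH; last by apply: sub_all al => y; rewrite !inE orbC.
exact: (@reduced_catr [:: i]).
Qed.

(** The relator of length [2k] splits after [k+1] letters: its prefix equals the reverse of the
    remaining [k-1] letters, so the alternating word of length [k+1] is not reduced. *)
Lemma reduced_alt_size i j k p :
  m i j = Some k -> reduced (alt i j p) -> 0 < k -> p <= k.
Proof.
move=> mij r k0; case: (leqP p k) => // ltkp.
move: r; have -> : alt i j p = (alt i j k.+1 ++ drop k.+1 (alt i j p)).
  by rewrite -(take_alt i j ltkp) cat_take_drop.
move=> /reduced_catl.
have le2 : k.+1 <= k.*2 by lia.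
rewrite -(take_alt i j le2); set x := take _ _ => rx.
set y := drop k.+1 (alt i j k.*2).
have : x =~ rev y.
  apply: coxeq_cancel; rewrite revK cat_take_drop -rel_word_alt.
  by have := coxeq_rel [::] [::] mij; rewrite /= cats0.
by move/rx; rewrite size_rev size_drop /x size_takel !size_alt; lia.
Qed.

(** As long as [i] or [j] shortens [v], that letter is split off [v] and moved to the end of [a].
    The tail gets shorter each time, so this stops. *)
Lemma dihedral_prefix i j a v :
  reduced (a ++ v) -> all (mem [:: i; j]) a ->
  exists a' v', [/\ a ++ v =~ a' ++ v', size (a' ++ v') = size (a ++ v),
    size v' <= size v, all (mem [:: i; j]) a' & reduced (i :: v') /\ reduced (j :: v')].
Proof.
have [q] := ubnP (size v); elim: q a v => // q IH a v lt_vq rav ija.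
case: (classic (reduced (i :: v) /\ reduced (j :: v))) => [rr|nrr].
  by exists a, v; split=> //; apply: coxeq_refl.
have [x xij nr] : exists2 x, x \in [:: i; j] & ~ reduced (x :: v).
  case/not_and_or: nrr => nr; first by exists i; rewrite ?inE ?eqxx.
  by exists j; rewrite ?inE ?eqxx ?orbT.
have [v' vE sv] := nreduced_cons (reduced_catr rav) nr.
have avE : a ++ v =~ (a ++ [:: x]) ++ v'.
  by rewrite -catA; apply: coxeq_cat vE; apply: coxeq_refl.
have sE : size ((a ++ [:: x]) ++ v') = size (a ++ v).
  by rewrite !size_cat /= sv; lia.
have [||| a' [v'' [e1 e2 e3 e4 e5]]] := IH (a ++ [:: x]) v'.
- by lia.
- exact: reduced_coxeq rav avE sE.
- by rewrite all_cat ija /= xij.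
exists a', v''; split=> //; [exact: coxeq_trans avE e1|by rewrite e2|by lia].
Qed.

End Congruence.

(** * Counting and choosing representatives *)

(** Greedy choice: a family of [p] pairwise inequivalent members either already covers [X] or is
    extended by an uncovered one. *)
Lemma has_at_least_or_covered n (m : 'I_n -> 'I_n -> option nat)
    (X : word n -> Prop) p :
  has_at_least m X p \/
  exists k (t : 'I_k -> word n), [/\ (k < p)%N, forall a, X (t a) &
    forall u, X u -> exists a, coxeq m u (t a)].
Proof.
elim: p => [|p [[t [tX tI]]|[k [t [ltkp tX Xt]]]]].
- by left; exists (fun=> [::]); split; case.
- case: (classic (forall u, X u -> exists a, coxeq m u (t a))) => [Xt|].
    by right; exists p, t.
  move=> /not_all_ex_not[u nu]; have [Xu nt] := imply_to_and _ _ nu.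
  left; exists (fun a => oapp t u (unlift ord0 a)); split.
    by move=> a; case: unlift => [b|] /=; [apply: tX|].
  move=> a b; case: unliftP => [a' ->|->]; case: unliftP => [b' ->|->] //= e.
  - by rewrite (tI _ _ e).
  - by case: nt; exists a'; apply: coxeq_sym.
  - by case: nt; exists b'.
- by right; exists k, t; split=> //; apply: ltnW.
Qed.

Lemma finite_fibres (G : Type) (T : eqType) (F : G -> T) (s : seq T) :
  exists l : list G, forall g, F g \in s -> exists c, List.In c l /\ F c = F g.
Proof.
elim: s => [|x s [l IH]]; first by exists [::].
case: (classic (exists c, F c = x)) => [[c Fc]|nex].
  exists (c :: l) => g; rewrite inE => /orP[/eqP ->|/IH[d [dl Fd]]].
    by exists c; split=> //; left.
  by exists d; split=> //; right.
exists l => g; rewrite inE => /orP[/eqP Fg|/IH//].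
by case: nex; exists g.
Qed.

Local Open Scope ring_scope.

(** * Gram matrices *)

Section Gram.
Variables (R : realFieldType) (n : nat).
Implicit Types O : seq 'cV[R]_n.

Definition gram O : 'M[R]_n := \sum_(v <- O) v *m v^T.

Lemma gram_sym O : (gram O)^T = gram O.
Proof.
by rewrite /gram linear_sum; apply: eq_bigr => v _ /=; rewrite trmx_mul trmxK.
Qed.

(** [z^T Q z] is the sum of the squares of the [u^T z], so over an ordered field it vanishes only if
    each term does. *)
Lemma gram_ker O (z : 'cV[R]_n) v : gram O *m z = 0 -> v \in O -> v^T *m z = 0.
Proof.
move=> Oz vO.
have : (z^T *m (gram O *m z)) 0 0 = \sum_(u <- O) ((u^T *m z) 0 0) ^+ 2.
  rewrite /gram mulmx_suml mulmx_sumr summxE; apply: eq_bigr => u _.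
  rewrite -mulmxA mulmxA -[z^T *m u]trmxK trmx_mul trmxK.
  by rewrite mxE big_ord1 [X in X * _]mxE expr2.
rewrite Oz mulmx0 mxE => /esym/eqP; rewrite psumr_eq0 => [|u _]; last exact: sqr_ge0.
move=> /allP /(_ v vO) /=; rewrite sqrf_eq0 => /eqP e.
by rewrite [LHS]mx11_scalar e raddf0.
Qed.

(** Everything in the kernel of the Gram matrix is killed by [v^T], so [v^T] lies in its row
    space. *)
Lemma gram_row O v : v \in O -> exists w, w *m gram O = v^T.
Proof.
move=> vO; suff /submxP[w ->] : (v^T <= gram O)%MS by exists w.
rewrite submxE; apply/eqP/matrixP => i j.
have e : gram O *m col j (cokermx (gram O)) = 0.
  by rewrite colE mulmxA mulmx_coker mul0mx.
have := gram_ker e vO; rewrite colE mulmxA -colE => /matrixP /(_ i 0).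
by rewrite [LHS]mxE [RHS]mxE => ->; rewrite mxE.
Qed.

Lemma gram_eq0 O v : gram O = 0 -> v \in O -> v = 0.
Proof.
move=> O0 /gram_row[w]; rewrite O0 mulmx0 => /esym v0.
by rewrite -[v]trmxK v0 trmx0.
Qed.

(** An invertible [g] mapping a duplicate-free finite list into itself permutes it, so the sum is
    merely reordered. *)
Lemma gram_stable O (g h : 'M[R]_n) :
  uniq O -> h *m g = 1%:M -> (forall v, v \in O -> g *m v \in O) ->
  g *m gram O *m g^T = gram O.
Proof.
move=> uO hg gO; rewrite /gram mulmx_sumr mulmx_suml.
have gI : injective (fun v : 'cV[R]_n => g *m v).
  by move=> u v /(congr1 (mulmx h)); rewrite !mulmxA hg !mul1mx.
have uM : uniq (map (fun v => g *m v) O) by rewrite map_inj_uniq.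
have sub : {subset map (fun v => g *m v) O <= O}.
  by move=> _ /mapP[v vO ->]; apply: gO.
have [|_ eqO] := uniq_min_size uM sub; first by rewrite size_map.
rewrite -[RHS](perm_big _ (uniq_perm uM uO eqO)) big_map.
by apply: eq_bigr => v _; rewrite trmx_mul !mulmxA.
Qed.
End Gram.

(** * The geometric representation *)

Section Representation.
Variables (R : realFieldType) (n : nat).

(* [cheb c k] is [U_(k-1)(c)] (Chebyshev, second kind): for [c = cos x] it equals
   [sin (k x) / sin x]. *)
Fixpoint cheb (c : R) k : R :=
  if k is k1.+1 then if k1 is k2.+1 then 2 * c * cheb c k1 - cheb c k2 else 1
  else 0.

Arguments cheb : simpl never.

Lemma chebS c k : cheb c k.+2 = 2 * c * cheb c k.+1 - cheb c k.
Proof. by []. Qed.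

Variable B : 'M[R]_n.

(* What is used of [B i j = - cos (pi / m i j)] (with [-1] for infinite [m i j]),
   so that the linear algebra needs only an ordered field. *)
Definition coxeter_form (m : 'I_n -> 'I_n -> option nat) : Prop :=
  [/\ B^T = B, forall i, B i i = 1 & forall i j, i != j ->
    if m i j is Some k then
      [/\ (1 < k)%N, forall p, (p <= k)%N -> 0 <= cheb (- B i j) p,
          cheb (- B i j) k.*2 = 0, cheb (- B i j) k.*2.+1 = 1 & B i j ^+ 2 != 1]
    else forall p, 0 <= cheb (- B i j) p].

Definition bil (x y : 'rV[R]_n) : R := (x *m B *m y^T) 0 0.
Definition vec (i : 'I_n) : 'rV[R]_n := delta_mx 0 i.
(** Matrices act on row vectors from the right; rows are vectors of V, and columns serve as linear
    forms, on which the same matrices act from the left. *)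
Definition refl_mx (a : 'rV[R]_n) : 'M[R]_n := 1%:M - 2 *: (B *m a^T *m a).
Definition wmx (w : word n) : 'M[R]_n :=
  foldr (fun i A => refl_mx (vec i) *m A) 1%:M w.

Lemma mul_refl_mx x a : x *m refl_mx a = x - (2 * bil x a) *: a.
Proof.
rewrite mulmxBr mulmx1 -scalemxAr !mulmxA -scalerA; congr (_ - _ *: _).
by rewrite [X in X *m _]mx11_scalar mul_scalar_mx.
Qed.

Lemma refl_mxE a : refl_mx a = 1%:M - 2 *: (B *m a^T *m a).
Proof. by []. Qed.

Lemma bilDl x y z : bil (x + y) z = bil x z + bil y z.
Proof. by rewrite /bil !mulmxDl mxE. Qed.
Lemma bilZl c x z : bil (c *: x) z = c * bil x z.
Proof. by rewrite /bil -!scalemxAl mxE. Qed.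
Lemma bil_vecr x i : bil x (vec i) = (x *m B) 0 i.
Proof. by rewrite /bil trmx_delta -colE mxE. Qed.
Lemma bil_vec i j : bil (vec i) (vec j) = B i j.
Proof. by rewrite bil_vecr -rowE mxE. Qed.

Lemma wmx_cat u v : wmx (u ++ v) = wmx u *m wmx v.
Proof. by elim: u => [|i u IH] /=; rewrite ?mul1mx // IH mulmxA. Qed.

Definition bilE := (bilDl, bilZl, bil_vec).

Hypothesis Bsym : B^T = B.
Hypothesis Bdiag : forall i, B i i = 1.

Lemma wmx_rot (c : R) i j p k : i != j -> B i j = - c ->
  (cheb c p.+1 *: vec i + cheb c p *: vec j) *m wmx (alt j i k)
  = cheb c (p + k).+1 *: vec (if odd k then j else i)
    + cheb c (p + k) *: vec (if odd k then i else j).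
Proof.
move=> + Bij; elim: k p i j Bij => [|k IH] p i j Bij ij /=.
  by rewrite mulmx1 addn0.
have Bji : B j i = - c by rewrite -Bsym mxE.
rewrite mulmxA mul_refl_mx !bilE Bij Bdiag.
have -> : cheb c p.+1 *: vec i + cheb c p *: vec j
   - (2 * (cheb c p.+1 * - c + cheb c p * 1)) *: vec j
   = cheb c p.+2 *: vec j + cheb c p.+1 *: vec i.
  rewrite chebS -addrA -scalerBl addrC; congr (_ *: _ + _); ring.
by rewrite IH 1?eq_sym // addSnnS; case: (odd k).
Qed.

Lemma vec_refl_mx i : vec i *m refl_mx (vec i) = - vec i.
Proof.
rewrite mul_refl_mx bil_vec Bdiag -[X in X - _]scale1r -scalerBl -scaleN1r.
by congr (_ *: _); ring.
Qed.

Lemma wmx_invol i : refl_mx (vec i) *m refl_mx (vec i) = 1%:M.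
Proof.
apply/row_matrixP => l; rewrite !rowE mulmxA mulmx1 !mul_refl_mx.
rewrite -!scaleNr !bilDl !bilZl bil_vec Bdiag.
rewrite -addrA -scalerDl.
set b := bil _ _; have -> : - (2 * b) - 2 * (b + - (2 * b) * 1) = 0 by ring.
by rewrite scale0r addr0.
Qed.

(* Off the plane spanned by [vec i] and [vec j], which is nondegenerate as
   [c ^+ 2 != 1], split a vector into a part in the plane and one orthogonal to it. *)
Lemma wmx_rel c i j k : i != j -> B i j = - c -> (0 < k)%N -> c ^+ 2 != 1 ->
  cheb c k.*2 = 0 -> cheb c k.*2.+1 = 1 -> wmx (rel_word i j k) = 1%:M.
Proof.
move=> ij Bij k0 c2 u0 u1; rewrite rel_word_alt; set W := wmx _.
have Bji : B j i = - c by rewrite -Bsym mxE.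
have fixj : vec j *m W = vec j.
  have := @wmx_rot c j i 0 k.*2; rewrite eq_sym => /(_ ij Bji).
  by rewrite /= [cheb c 1]/(1) [cheb c 0]/(0) scale1r scale0r addr0 add0n u0 u1
    odd_double scale1r scale0r addr0.
(* The first letter negates [vec i]. The remaining [2k-1] letters negate it again, since the
   recurrence gives -1 for [cheb c] at [2k-1]. *)
have fixi : vec i *m W = vec i.
  rewrite /W; move: u0 u1; case: k k0 {W fixj} => // k _; rewrite doubleS => u0.
  rewrite chebS u0 mulr0 sub0r => /eqP; rewrite eqr_oppLR => /eqP u1.
  rewrite [alt _ _ _]/= [wmx _]/= mulmxA vec_refl_mx.
  have := @wmx_rot c i j 0 k.*2.+1 ij Bij.
  rewrite add0n [cheb c 1]/(1) [cheb c 0]/(0) scale1r scale0r addr0 /= odd_double /=.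
  by rewrite u0 u1 scale0r add0r scaleN1r mulNmx => ->; rewrite opprK.
have span a b : (a *: vec i + b *: vec j) *m W = a *: vec i + b *: vec j.
  by rewrite mulmxDl -!scalemxAl fixi fixj.
have perp x : bil x (vec i) = 0 -> bil x (vec j) = 0 -> x *m W = x.
  move=> xi xj; rewrite /W; elim: k.*2 {W fixi fixj span u0 u1 k0} (i) (j) xi xj
    => [|q IH] i' j' xi xj /=; first by rewrite mulmx1.
  by rewrite mulmxA mul_refl_mx xi mulr0 scale0r subr0 IH.
apply/row_matrixP => l; rewrite !rowE mulmx1 -/(vec l).
pose d := 1 - c ^+ 2; have d0 : d != 0 by rewrite subr_eq0 eq_sym.
(* Cramer's rule for the Gram matrix of [vec i] and [vec j], whose determinant is [d]. *)
pose a := (B l i + c * B l j) / d; pose b := (B l j + c * B l i) / d.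
have -> : vec l = (vec l + (- a *: vec i + - b *: vec j)) + (a *: vec i + b *: vec j).
  by rewrite -addrA addrACA -!scalerDl !addNr !scale0r !addr0.
by rewrite mulmxDl span perp // !bilE Bdiag ?Bij ?Bji /a /b /d; field.
Qed.

End Representation.

(** * The representation of the group and its faithfulness *)

Section CoxeterForm.
Variables (R : realFieldType) (n : nat) (m : 'I_n -> 'I_n -> option nat).
Variable B : 'M[R]_n.
Hypothesis mdiag : forall i, m i i = Some 1%N.
Hypothesis formB : coxeter_form B m.

Local Notation vec := (@vec R n).
Local Notation wmx := (wmx B).
Local Notation refl_mx := (refl_mx B).
Local Notation bil := (bil B).

Let Bsym : B^T = B. Proof. by case: formB. Qed.
Let Bdiag i : B i i = 1. Proof. by case: formB. Qed.

Lemma wmx_coxeq u v : coxeq m u v -> wmx u = wmx v.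
Proof.
elim=> {u v} // [u v w _ -> _ //|l r i j k mij].
rewrite !wmx_cat; suff -> : wmx (rel_word i j k) = 1%:M by rewrite mul1mx.
have [ij|ij] := eqVneq i j.
  move: mij; rewrite ij mdiag => -[<-] /=; rewrite mulmx1; exact: wmx_invol.
case: formB => _ _ /(_ i j ij); rewrite mij => -[k1 _ u0 u1 c1].
apply: (@wmx_rel R n B Bsym Bdiag (- B i j)) => //; rewrite ?opprK ?sqrrN //; lia.
Qed.

Lemma wmx_revK u : wmx u *m wmx (rev u) = 1%:M.
Proof. by rewrite -wmx_cat (wmx_coxeq (coxeq_revK mdiag u)). Qed.

Lemma wmx_Krev u : wmx (rev u) *m wmx u = 1%:M.
Proof. by rewrite -wmx_cat (wmx_coxeq (coxeq_Krev mdiag u)). Qed.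

Lemma cheb_ge0 i j w : i != j -> reduced m (i :: w) -> w = alt j i (size w) ->
  0 <= cheb (- B i j) (size w) /\ 0 <= cheb (- B i j) (size w).+1.
Proof.
move=> ij r e; case: formB => _ _ /(_ i j ij).
case mij : (m i j) => [k|]; last by move=> p; split; apply: p.
move=> -[k1 pos _ _ _].
have : (size w < k)%N.
  by have := reduced_alt_size mdiag (p := (size w).+1) mij; rewrite /= -e => /(_ r); lia.
by move=> lt; split; apply: pos; lia.
Qed.

(* Split off a maximal prefix of [w] in the dihedral group generated by [i] and
   the first letter of [w]: the rest is handled by induction, and the prefix by
   the nonnegativity of Chebyshev values (Humphreys, Reflection Groups and
   Coxeter Groups, 5.4). *)
Lemma wmx_pos i w l : reduced m (i :: w) -> 0 <= (vec i *m wmx w) 0 l.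
Proof.
have [q] := ubnP (size w); elim: q i w l => // q IH i [|j w] l lt_wq riw.
  by rewrite mulmx1 mxE ler0n.
have ij : i != j.
  apply/eqP => ij; rewrite -ij in riw.
  by have := riw _ (coxeq_invol mdiag i w); rewrite /=; lia.
have rjw : reduced m ([:: j] ++ w) by apply: (reduced_catr (u := [:: i])).
(* Starting from the nonempty prefix [[:: j]] makes the tail [v] strictly shorter than [j :: w], as
   the induction requires. *)
have [|a [v [wE sE sv ija [ri rj]]]] := @dihedral_prefix n m mdiag i j [:: j] w rjw.
  by rewrite /= !inE eqxx orbT.
have ria : reduced m (i :: a).
  apply: (reduced_catl (v := v)).
  apply: (reduced_coxeq riw); last by rewrite /= sE.
  exact: (coxeq_cat (coxeq_refl m [:: i]) wE).
have aE := reduced_alt mdiag ria ija.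
have [u1 u2] := cheb_ge0 ij ria aE.
rewrite (wmx_coxeq wE) wmx_cat mulmxA aE.
have := @wmx_rot R n B Bsym Bdiag (- B i j) i j 0 (size a) ij (esym (opprK _)).
rewrite [cheb _ 1]/(1) [cheb _ 0]/(0) scale1r scale0r addr0 add0n => ->.
rewrite mulmxDl -!scalemxAl mxE [X in X + _]mxE [X in _ + X]mxE.
by apply: addr_ge0; apply: mulr_ge0 => //; case: odd; apply: IH => //; apply: leq_ltn_trans sv _.
Qed.

(** If a nonempty reduced word [i :: w] acted trivially, [w] would send [vec i] to its negative,
    contradicting positivity of the coordinates. *)
Lemma wmx_faithful u v : wmx u = wmx v -> coxeq m u v.
Proof.
move=> uv; apply: coxeq_cancel => //.
have : wmx (u ++ rev v) = 1%:M by rewrite wmx_cat uv wmx_revK.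
have [w ww rw] := reduced_exists m (u ++ rev v).
rewrite (wmx_coxeq ww); case: w ww rw => [//|i w] _ rw w1.
have := @wmx_pos i w i rw.
have vE : vec i *m wmx w = - vec i.
  have : vec i *m wmx (i :: w) = - (vec i *m wmx w).
    by rewrite /= mulmxA vec_refl_mx // mulNmx.
  by rewrite w1 mulmx1 => e; rewrite -[vec i *m _]opprK -e.
rewrite vE !mxE !eqxx /=; lra.
Qed.

(** * Finite orbits *)

Lemma refl_mx_tr x : (refl_mx x)^T = 1%:M - 2 *: (x^T *m x *m B).
Proof. by rewrite [LHS]linearB /= linearZ /= trmx1 !trmx_mul trmxK Bsym !mulmxA. Qed.

Lemma wmx_form w : wmx w *m B *m (wmx w)^T = B.
Proof.
elim: w => [|i w IH] /=; first by rewrite mul1mx trmx1 mulmx1.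
rewrite trmx_mul !mulmxA -[_ *m _ *m B]mulmxA -[_ *m _ *m (wmx w)^T]mulmxA IH.
suff e : refl_mx (vec i) *m B = B *m (refl_mx (vec i))^T.
  by rewrite e -mulmxA -trmx_mul wmx_invol // trmx1 mulmx1.
rewrite refl_mx_tr refl_mxE mulmxBl mulmxBr mul1mx mulmx1.
by rewrite -scalemxAl -scalemxAr !mulmxA.
Qed.

(** By invariance of [B], conjugating a simple reflection gives the reflection in the transported
    root. *)
Lemma wmx_reflection w i :
  wmx (w ++ [:: i] ++ rev w) = refl_mx (vec i *m wmx (rev w)).
Proof.
rewrite !wmx_cat /= mulmx1 !refl_mxE trmx_mul.
have WB : wmx w *m B = B *m (wmx (rev w))^T.
  have /= := congr1 (mulmx^~ (wmx (rev w))^T) (wmx_form w).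
  by rewrite -mulmxA -trmx_mul wmx_Krev trmx1 mulmx1.
rewrite mulmxBl mulmxBr mul1mx wmx_revK; congr (_ - _).
by rewrite -scalemxAl -scalemxAr !mulmxA WB.
Qed.

Lemma gen_by_wmx (X : word n -> Prop) (P : 'M[R]_n -> Prop) :
  P 1%:M -> (forall g h, P g -> P h -> P (g *m h)) ->
  (forall g h, P g -> h *m g = 1%:M -> g *m h = 1%:M -> P h) ->
  (forall t, X t -> P (wmx t)) -> forall g, gen_by m X g -> P (wmx g).
Proof.
move=> P1 PM PV PX g; elim=> {g} // [u v _ Pu _ Pv|u _ Pu|u v _ Pu uv].
- by rewrite wmx_cat; apply: PM.
- exact: (PV _ _ Pu (wmx_Krev u) (wmx_revK u)).
- by rewrite -(wmx_coxeq uv).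
Qed.

Lemma gen_by_fix_col X (f : 'cV[R]_n) : (forall t, X t -> wmx t *m f = f) ->
  forall g, gen_by m X g -> wmx g *m f = f.
Proof.
move=> Xf; apply: (gen_by_wmx (P := fun g => g *m f = f)) => //.
- by rewrite mul1mx.
- by move=> g h gf hf; rewrite -mulmxA hf gf.
- by move=> g h gf hg _; rewrite -{1}gf mulmxA hg mul1mx.
Qed.

Lemma gen_by_fix_row X (x : 'rV[R]_n) : (forall t, X t -> x *m wmx t = x) ->
  forall g, gen_by m X g -> x *m wmx g = x.
Proof.
move=> Xf; apply: (gen_by_wmx (P := fun g => x *m g = x)) => //.
- by rewrite mulmx1.
- by move=> g h gf hf; rewrite mulmxA gf hf.
- by move=> g h gf _ gh; rewrite -{1}gf -mulmxA gh mulmx1.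
Qed.

Definition finite_orbit (x : 'rV[R]_n) :=
  exists s : seq 'rV[R]_n, forall g, x *m wmx g \in s.

Lemma finite_orbitB x y : finite_orbit x -> finite_orbit y -> finite_orbit (x - y).
Proof.
move=> [s xs] [t yt]; exists [seq u - v | u <- s, v <- t] => g.
by rewrite mulmxBl; apply/allpairsP; exists (x *m wmx g, y *m wmx g); split=> /=.
Qed.

Lemma finite_orbitZ c x : finite_orbit x -> finite_orbit (c *: x).
Proof.
move=> [s xs]; exists [seq c *: u | u <- s] => g.
by rewrite -scalemxAl; apply: map_f.
Qed.

Lemma finite_orbitM u x : finite_orbit x -> finite_orbit (x *m wmx u).
Proof.
by move=> [s xs]; exists s => g; rewrite -mulmxA -wmx_cat.
Qed.

(** The difference of [x] and its image under the simple reflection is [2 B(x, vec i)] times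
    [vec i]. *)
Lemma finite_orbit_root x i :
  finite_orbit x -> bil x (vec i) != 0 -> finite_orbit (vec i).
Proof.
move=> fx xi; set b := bil x (vec i) in xi.
have -> : vec i = (2 * b)^-1 *: (x - x *m wmx [:: i]).
  rewrite /= mulmx1 mul_refl_mx opprB addrC subrK scalerA mulVf ?scale1r //.
  by rewrite mulf_neq0 // pnatr_eq0.
by apply: finite_orbitZ; apply: finite_orbitB => //; apply: finite_orbitM.
Qed.

Section Cosets.
Variables (H : word n -> Prop).
Hypothesis Hfi : finite_index m H.

(** The image of [f] under [g] depends only on the left coset of [g], so coset representatives yield
    the whole orbit. *)
Lemma fixed_col_orbit (f : 'cV[R]_n) : (forall h, H h -> wmx h *m f = f) ->
  exists O : seq 'cV[R]_n, [/\ uniq O, f \in O &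
    forall g v, v \in O -> wmx g *m v \in O].
Proof.
move=> Hf; case: Hfi => l lP; pose O := undup [seq wmx c *m f | c <- l].
have gO g : wmx g *m f \in O.
  have [c cl /Hf] := lP g; rewrite wmx_cat => /(congr1 (mulmx (wmx c))).
  rewrite !mulmxA wmx_revK mul1mx => ->.
  by rewrite mem_undup; apply/mapP; exists c.
exists O; split; first exact: undup_uniq.
  by have := gO [::]; rewrite mul1mx.
by move=> g v; rewrite mem_undup => /mapP[c _ ->]; rewrite mulmxA -wmx_cat.
Qed.

Lemma fixed_row_orbit x : (forall h, H h -> x *m wmx h = x) -> finite_orbit x.
Proof.
move=> Hx; case: Hfi => l lP; exists [seq x *m wmx (rev c) | c <- l] => g.
(* The action on rows is constant on right cosets, while [finite_index] lists left ones; hence the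
   passage to the inverse [rev g]. *)
have [c cl /Hx] := lP (rev g); rewrite wmx_cat mulmxA => /(congr1 (mulmx^~ (wmx g))).
rewrite /= -mulmxA wmx_Krev mulmx1 => <-.
by apply/mapP; exists c.
Qed.
End Cosets.

(** By faithfulness an element is determined by its images of the simple roots, and only finitely
    many tuples of images occur. *)
Lemma finite_of_orbits : (forall i, finite_orbit (vec i)) ->
  exists l : seq (word n), forall g, exists2 c, c \in l & coxeq m g c.
Proof.
move=> /fin_all_exists[L LP]; pose s := flatten [seq L i | i <- enum 'I_n].
have sP i g : vec i *m wmx g \in s.
  by apply/flattenP; exists (L i); [apply: map_f; rewrite mem_enum|apply: LP].
pose F g := [ffun i => SeqSub (sP i g)].
have [l lP] := finite_fibres F (enum {ffun 'I_n -> seq_sub s}).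
exists l => g; have [|c [cl Fc]] := lP g; first by rewrite mem_enum.
exists c.
  by elim: l cl {lP} => //= d l IH [->|/IH]; rewrite inE ?eqxx // => ->; rewrite orbT.
apply: wmx_faithful; apply/row_matrixP => i; rewrite !rowE.
by move/ffunP: Fc => /(_ i); rewrite !ffunE => /(congr1 val).
Qed.

(** * Connectedness and invariant forms *)

Hypothesis mindec : cox_indecomposable m.
Hypothesis orthB : forall i j, i != j -> B i j = 0 -> m i j = Some 2%N.

Lemma coxeq_comm i j : m i j = Some 2%N -> coxeq m [:: i; j] [:: j; i].
Proof.
move=> mij; apply: (coxeq_cancel mdiag (v := [:: j; i])).
exact: (coxeq_rel [::] [::] mij).
Qed.

(** Otherwise the indices satisfying [P] and the remaining ones would be mutually orthogonal, hence
    commuting, and would decompose the system. *)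
Lemma connected_ind (P : 'I_n -> Prop) i0 : P i0 ->
  (forall i j, P i -> B i j != 0 -> P j) -> forall i, P i.
Proof.
move=> P0 PB.
have /fin_all_exists[p pP] i : exists b : bool, b <-> P i.
  by case: (classic (P i)) => Pi; [exists true|exists false].
move=> i1; apply/pP; apply/negPn/negP => np1; apply: mindec.
exists [set i | p i]; split.
- by apply/set0Pn; exists i0; rewrite inE; apply/pP.
- by apply/set0Pn; exists i1; rewrite !inE.
move=> i j; rewrite !inE => pi npj; apply: coxeq_comm; apply: orthB.
  by apply: contraNneq npj => <-.
apply/eqP; apply: contraNT npj => Bij; apply/pP; apply: PB Bij; exact/pP.
Qed.

(** Invariance under the reflection [i] forces row [i] of [Q] to be [Q i i] times that of [B];
    symmetry then equates the diagonal entries along nonzero entries of [B]. *)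
Lemma invariant_form (Q : 'M[R]_n) i0 : Q^T = Q ->
  (forall i, wmx [:: i] *m Q *m (wmx [:: i])^T = Q) -> Q = Q i0 i0 *: B.
Proof.
move=> Qsym QS.
have QB i j : Q i j = Q i i * B i j.
  have : vec i *m Q = - (vec i *m Q) + (2 * Q i i) *: (vec i *m B).
    rewrite -{1}(QS i) /= mulmx1 !mulmxA vec_refl_mx // refl_mx_tr !mulNmx mulmxBr mulmx1.
    rewrite opprB addrC; congr (_ + _).
    rewrite -scalemxAr !mulmxA -scalerA; congr (_ *: _).
    rewrite [_ *m (vec i)^T]mx11_scalar mul_scalar_mx -scalemxAl; congr (_ *: _).
    by rewrite trmx_delta -colE -rowE !mxE.
  by move=> /matrixP /(_ 0 j); rewrite -!rowE !mxE; lra.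
have Qdiag : forall i, Q i i = Q i0 i0.
  apply: (connected_ind (i0 := i0)) => // i j <- Bij.
  have sym (A : 'M[R]_n) : A^T = A -> A j i = A i j by move=> {1}<-; rewrite mxE.
  by apply: (mulIf Bij); rewrite -QB -(sym _ Qsym) (QB j i) (sym _ Bsym).
by apply/matrixP => i j; rewrite mxE QB Qdiag.
Qed.

Lemma finite_of_few_reflections (H X : word n -> Prop) k (t : 'I_k -> word n) :
  (k < n)%N -> finite_index m H -> (forall g, H g -> gen_by m X g) ->
  (forall a, is_reflection m (t a)) ->
  (forall u, X u -> exists a, coxeq m u (t a)) ->
  exists l : seq (word n), forall g, exists2 c, c \in l & coxeq m g c.
Proof.
move=> ltkn Hfi HX trefl Xt.
have /fin_all_exists[r rP] a : exists x, wmx (t a) = refl_mx x.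
  have [w [i ti]] := trefl a; exists (vec i *m wmx (rev w)).
  by rewrite (wmx_coxeq ti) wmx_reflection.
have Xr u : X u -> exists a, wmx u = refl_mx (r a).
  by move=> /Xt[a ua]; exists a; rewrite (wmx_coxeq ua).
(* Fewer than [n] roots span a proper subspace, which a nonzero linear form annihilates. *)
have [f f0 fr] : exists2 f : 'cV[R]_n, f != 0 & forall a, r a *m f = 0.
  pose A := \matrix_(a < k) r a.
  have : kermx A^T != 0.
    by rewrite kermx_eq0 -row_leq_rank -ltnNge (leq_ltn_trans (rank_leq_col _)).
  case/rowV0Pn => v /sub_kermxP vA v0; exists v^T.
    by rewrite -(inj_eq trmx_inj) trmxK trmx0.
  move=> a; rewrite -(rowK r a) -row_mul -[A *m _]trmxK trmx_mul trmxK vA.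
  by rewrite trmx0 row0.
have Hf g : H g -> wmx g *m f = f.
  move=> /HX; apply: gen_by_fix_col => u /Xr[a ->].
  by rewrite refl_mxE mulmxBl mul1mx -scalemxAl -!mulmxA fr !mulmx0 scaler0 subr0.
have [O [uO fO gO]] := fixed_col_orbit Hfi Hf.
have [i0 _] : exists i0, f i0 0 != 0.
  apply/existsP; apply: contraNT f0 => /existsPn h; apply/eqP/matrixP => i j.
  by rewrite ord1 mxE; apply/eqP; have := h i; rewrite negbK.
have QB : gram O = gram O i0 i0 *: B.
  apply: invariant_form => [|i]; first exact: gram_sym.
  apply: (gram_stable (h := wmx (rev [:: i]))) => //; last exact: gO.
  exact: wmx_Krev.
set q := gram O i0 i0 in QB.
have [w wf] := gram_row fO.
have wB : q *: (w *m B) = f^T by rewrite scalemxAr -QB.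
have q0 : q != 0.
  apply: contraNneq f0 => q0; apply/eqP; apply: gram_eq0 fO.
  by rewrite QB q0 scale0r.
(* As [f] is [q] times the form [B(w, -)] with [q] nonzero, [w] is orthogonal to every root that [f]
   annihilates. *)
have wr a : bil w (r a) = 0.
  apply: (mulfI q0); rewrite mulr0 -[bil _ _]/((w *m B *m (r a)^T) 0 0).
  have -> : q * (w *m B *m (r a)^T) 0 0 = ((q *: (w *m B)) *m (r a)^T) 0 0.
    by rewrite -scalemxAl [RHS]mxE.
  by rewrite wB -trmx_mul fr trmx0 mxE.
have Hw g : H g -> w *m wmx g = w.
  move=> /HX; apply: gen_by_fix_row => u /Xr[a ->].
  by rewrite mul_refl_mx wr mulr0 scale0r subr0.
have fw := fixed_row_orbit Hfi Hw.
apply: finite_of_orbits.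
(* If [w] were orthogonal to all simple roots, [w B] and hence [f] would vanish. *)
have [i1 wi1] : exists i, bil w (vec i) != 0.
  apply/existsP; apply: contraNT f0 => /existsPn h; rewrite -[f]trmxK -wB.
  apply/eqP; rewrite -[RHS]trmx0; congr trmx; rewrite -(scaler0 _ q); congr (_ *: _).
  apply/matrixP => i j; rewrite ord1 [RHS]mxE; apply/eqP.
  by have := h j; rewrite bil_vecr negbK.
apply: (connected_ind (i0 := i1)); first exact: finite_orbit_root wi1.
by move=> i j fi Bij; apply: (finite_orbit_root fi); rewrite bil_vec.
Qed.
End CoxeterForm.

(** * The cosine matrix *)

Section Cosine.
Variable R : realType.

Lemma nat_ind2 (P : nat -> Prop) :
  P 0%N -> P 1%N -> (forall k, P k -> P k.+1 -> P k.+2) -> forall k, P k.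
Proof.
move=> P0 P1 PS k; suff [] : P k /\ P k.+1 by [].
by elim: k => // k [Pk Pk1]; split=> //; apply: PS.
Qed.

Lemma cheb1 k : cheb 1 k = k%:R :> R.
Proof.
elim/nat_ind2: k => // k IH0 IH1; rewrite chebS IH0 IH1 -!natr1; ring.
Qed.

Lemma cheb_cos (x : R) k : cheb (cos x) k * sin x = sin (k%:R * x).
Proof.
elim/nat_ind2: k => [||k IH0 IH1]; rewrite ?mul0r ?sin0 ?mul1r //.
rewrite chebS mulrBl -(mulrA (2 * cos x)) IH0 IH1.
have -> : k.+2%:R * x = k.+1%:R * x + x by rewrite -[k.+2%:R]natr1; ring.
have -> : k%:R * x = k.+1%:R * x - x by rewrite -[k.+1%:R]natr1; ring.
by rewrite sinB sinD; ring.
Qed.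

Definition cos_form n (m : 'I_n -> 'I_n -> option nat) : 'M[R]_n :=
  \matrix_(i, j) if m i j is Some k then - cos (pi / k%:R) else -1.

(** With [x = pi / k], multiplying by [sin x > 0] turns Chebyshev values into [sin (p x)]:
    nonnegative for [p x <= pi], and at [2k] and [2k+1] read off from [2k x = 2 pi]. *)
Lemma cos_formP n (m : 'I_n -> 'I_n -> option nat) :
  coxeter_matrix m -> coxeter_form (cos_form m) m.
Proof.
move=> [mdiag [msym m2]]; split=> [|i|i j ij].
- by apply/matrixP => i j; rewrite !mxE msym.
- by rewrite mxE mdiag divr1 cospi opprK.
rewrite mxE; case mij : (m i j) => [k|]; last by move=> p; rewrite opprK cheb1 ler0n.
have k2 := m2 i j ij k mij; rewrite opprK.
have k0 : (0 : R) < k%:R by rewrite ltr0n; lia.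
have ks : pi / k%:R * k%:R = pi :> R by rewrite divfK // gt_eqF.
set x := pi / k%:R in ks *.
have x0 : 0 < x by rewrite divr_gt0 ?pi_gt0.
have xpi : x < pi by rewrite ltr_pdivrMr // ltr_pMr ?pi_gt0 // ltr1n.
have sx : 0 < sin x by apply: sin_gt0_pi; rewrite x0.
have kx2 : k.*2%:R * x = pi *+ 2 by rewrite -muln2 natrM mulrC mulrA ks mulr_natr.
split=> // [p lepk|||].
- rewrite -(pmulr_lge0 _ sx) cheb_cos; apply: sin_ge0_pi.
  by rewrite mulr_ge0 ?ler0n ?(ltW x0) //= -ks mulrC ler_pM2l // ler_nat.
- apply: (mulIf (lt0r_neq0 sx)).
  by rewrite cheb_cos mul0r kx2 sin2pi.
- apply: (mulIf (lt0r_neq0 sx)); rewrite cheb_cos mul1r -natr1 mulrDl mul1r.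
  by rewrite kx2 addrC sinD2pi.
- rewrite sqrrN lt_eqF // -subr_gt0 -sin2cos2 exprn_gt0 //.
Qed.

Lemma cos_form_orth n (m : 'I_n -> 'I_n -> option nat) i j :
  coxeter_matrix m -> i != j -> cos_form m i j = 0 -> m i j = Some 2%N.
Proof.
move=> [_ [_ m2]] ij; rewrite mxE; case mij : (m i j) => [k|]; last first.
  by move/eqP; rewrite oppr_eq0 oner_eq0.
have := m2 i j ij k mij; rewrite leq_eqVlt => /orP[/eqP<- //|k2].
have k0 : (0 : R) < k%:R by rewrite ltr0n; lia.
move/eqP; rewrite oppr_eq0 gt_eqF // cos_gt0_pihalf //; apply/andP; split.
  by apply: (@lt_trans _ _ 0); rewrite ?oppr_lt0 divr_gt0 ?pi_gt0.
by rewrite ltr_pM2l ?pi_gt0 // ltf_pV2 ?posrE // ltr_nat.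
Qed.
End Cosine.

Local Close Scope ring_scope.

Theorem theorem1p2 (n : nat) (m : 'I_n -> 'I_n -> option nat) :
  coxeter_matrix m -> cox_infinite m -> cox_indecomposable m ->
  forall H : word n -> Prop,
    is_subgroup m H ->
    (exists R0 : word n -> Prop, (forall t, R0 t -> is_reflection m t) /\
        (forall g, H g <-> gen_by m R0 g)) ->
    finite_index m H ->
    forall R : word n -> Prop,
      elem_set m R ->
      (forall t, R t -> is_reflection m t) ->
      (forall g, H g <-> gen_by m R g) ->
      has_at_least m R n.
Proof.
move=> mcox minf mindec H _ _ Hfi X _ Xrefl HX.
(* Otherwise fewer than [n] reflections represent all of [X], and the group would be finite. *)
case: (has_at_least_or_covered m X n) => // -[k [t [ltkn tX Xt]]].
case: minf; apply: (@finite_of_few_reflections Rdefinitions.R n m (cos_form _ m)) Xt => //.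
- by case: mcox.
- exact: cos_formP.
- by move=> i j; apply: cos_form_orth.
- exact: Hfi.
- by move=> g /HX.
- by move=> a; apply: Xrefl.
Qed.
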